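(* Let $K$ be a commutative ring, let $A$ be an associative unital $K$-algebra, and let $e_1,\dots,e_m$ be a complete set of orthogonal idempotents in $A$. If $\langle -,-\rangle$ is a noncommutative Poisson structure on $A$, then for any $\alpha\in\mathbb{N}^m$ there is a unique Poisson bracket $\{-,-\}$ on the commutative $K$-algebra $\mathrm{T}(A,\alpha)$ with the property that \[ \{ \mathrm{tr}_{\alpha}\, a, \mathrm{tr}_{\alpha}\, b \} = \mathrm{tr}_{\alpha} \langle \overline a,\overline b \rangle \] for all $a,b\in A$.
   Context: Throughout, $K$ is a commutative ring, $A$ is an associative $K$-algebra with $1$, and all maps (derivations, brackets) are $K$-linear (respectively $K$-bilinear). Complete set of orthogonal idempotents: $e_1,\dots,e_m\in A$ with $e_i^2=e_i$, $e_ie_j=0$ for $i\neq j$, and $e_1+\dots+e_m=1$. Commutator quotient: $[A,A]$ denotes the $K$-submodule of $A$ spanned by the commutators $[a,b]=ab-ba$, and $\overline a$ denotes the image of $a\in A$ in $A/[A,A]$. If $d:A\to A$ is a derivation, then $d([A,A])\subseteq [A,A]$, so $d$ induces a linear map $\overline d:A/[A,A]\to A/[A,A]$, $\overline a\mapsto\overline{d(a)}$. Noncommutative Poisson structure on $A$: a Lie bracket $\langle -,-\rangle$ on the $K$-module $A/[A,A]$ such that for each $a\in A$ the map $\langle \overline a,-\rangle:A/[A,A]\to A/[A,A]$ is induced by a derivation $d_a:A\to A$, i.e. $\langle\overline a,\overline b\rangle=\overline{d_a(b)}$ for all $b\in A$. (A Lie bracket is $K$-bilinear, alternating, i.e. the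 bracket of any element with itself is zero, and satisfies the Jacobi identity.) Poisson bracket on a commutative $K$-algebra $B$: a Lie bracket $\{-,-\}:B\times B\to B$ satisfying the Leibniz rule $\{a,bc\}=b\{a,c\}+\{a,b\}c$ for all $a,b,c\in B$. Representation scheme: for $\alpha=(\alpha_1,\dots,\alpha_m)\in\mathbb{N}^m$ put $n=\alpha_1+\dots+\alpha_m$, and for $1\le v\le m$ let $\Delta^v$ be the $n\times n$ matrix with $\Delta^v_{ij}=1$ if $i=j$ and $\sum_{w<v}\alpha_w<i\le\sum_{w\le v}\alpha_w$, and $\Delta^v_{ij}=0$ otherwise. The commutative $K$-algebra $K[\mathrm{Rep}(A,\alpha)]$ is generated by elements $a_{ij}$ with $a\in A$ and $1\le i,j\le n$, subject to the relations \[ (ab)_{ij}=\sum_{k=1}^n a_{ik}b_{kj},\qquad (\lambda a+\mu b)_{ij}=\lambda a_{ij}+\mu b_{ij},\qquad (e_v)_{ij}=\Delta^v_{ij} \] for all $a,b\in A$, $\lambda,\mu\in K$, $1\le i,j\le n$, $1\le v\le m$. (It is the coordinate ring of the affine scheme $\mathrm{Rep}(A,\alpha)$ whose $S$-valued points, for a commutative $K$-algebra $S$, are the $K$-algebra homomorphisms $A\to M_n(S)$ sending $e_v$ to $\Delta^v$ for each $v$.) Trace functions: for $a\in A$, $\mathrm{tr}_\alpha\, a=\sum_{i=1}^n a_{ii}\in K[\mathrm{Rep}(A,\alpha)]$. Since $\mathrm{tr}_\alpha(ab)=\mathrm{tr}_\alpha(ba)$, this induces a linear map $A/[A,A]\to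 K[\mathrm{Rep}(A,\alpha)]$, also denoted $\mathrm{tr}_\alpha$. $\mathrm{T}(A,\alpha)$ is the $K$-subalgebra of $K[\mathrm{Rep}(A,\alpha)]$ generated by the elements $\mathrm{tr}_\alpha\, a$ with $a\in A$. *)

(* Defs.v *)
From HB Require Import structures.
From mathcomp Require Import all_boot all_algebra.
From mathcomp Require Import boolp.

Set Implicit Arguments.
Unset Strict Implicit.
Unset Printing Implicit Defensive.

Import GRing.Theory.
Local Open Scope ring_scope.

(* MathComp's algType only covers nonzero rings, but K[Rep(A, alpha)] can be  *)
(* the zero ring, and neither A nor K is assumed to be nonzero.  Since        *)
(* Hierarchy Builder admits no join of lmodType and pzRingType below          *)
(* lSemiAlgType, the scaling is an operation ascale of its own, and as_lmod   *)
(* equips the same carrier with the lmodType structure.                       *)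
HB.mixin Record isAssocAlgebra (K : comPzRingType) A of GRing.PzRing A := {
  ascale : K -> A -> A;
  ascaleA : forall k l x, ascale k (ascale l x) = ascale (k * l) x;
  ascale1 : left_id 1 ascale;
  ascaleDr : right_distributive ascale +%R;
  ascaleDl : forall x, {morph ascale^~ x : k l / k + l};
  ascaleAl : forall k x y, ascale k (x * y) = ascale k x * y;
  ascaleAr : forall k x y, ascale k (x * y) = x * ascale k y
}.

#[short(type="assocAlgType")]
HB.structure Definition AssocAlgebra (K : comPzRingType) :=
  {A of GRing.PzRing A & isAssocAlgebra K A}.

#[short(type="comAssocAlgType")]
HB.structure Definition ComAssocAlgebra (K : comPzRingType) :=
  {B of GRing.ComPzRing B & AssocAlgebra K B}.

Definition as_lmod (K : comPzRingType) (A : assocAlgType K) : Type := A.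

HB.instance Definition _ (K : comPzRingType) (A : assocAlgType K) :=
  GRing.Zmodule.on (as_lmod A).
HB.instance Definition _ (K : comPzRingType) (A : assocAlgType K) :=
  GRing.Zmodule_isLmodule.Build K (as_lmod A)
    (@ascaleA K A) (@ascale1 K A) (@ascaleDr K A) (@ascaleDl K A).

Lemma ascaleN1 (K : comPzRingType) (A : assocAlgType K) (x : A) :
  ascale (-1 : K) x = - x.
Proof. exact: (@scaleN1r K (as_lmod A)). Qed.

Section Notions.
Variable K : comPzRingType.

Inductive span (V : lmodType K) (S : V -> Prop) : V -> Prop :=
| span_gen x : S x -> span S x
| span0 : span S 0
| spanD x y : span S x -> span S y -> span S (x + y)
| spanZ k x : span S x -> span S (k *: x).

Inductive subalg_gen (B : assocAlgType K) (S : B -> Prop) : B -> Prop :=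
| subalg_gen_gen x : S x -> subalg_gen S x
| subalg_gen1 : subalg_gen S 1
| subalg_genD x y : subalg_gen S x -> subalg_gen S y -> subalg_gen S (x + y)
| subalg_genM x y : subalg_gen S x -> subalg_gen S y -> subalg_gen S (x * y)
| subalg_genZ k x : subalg_gen S x -> subalg_gen S (ascale k x).

Record lie_bracket (L : lmodType K) (br : L -> L -> L) : Prop := {
  lie_linearl : forall y, linear (br ^~ y);
  lie_linearr : forall x, linear (br x);
  lie_alternating : forall x, br x x = 0;
  lie_jacobi : forall x y z, br x (br y z) + br y (br z x) + br z (br x y) = 0
}.

Record derivation (A : assocAlgType K) (d : A -> A) : Prop := {
  derivation_linear : linear (d : as_lmod A -> as_lmod A);
  derivationM : forall a b, d (a * b) = d a * b + a * d b
}.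

Record poisson_bracket (B : comAssocAlgType K) (br : B -> B -> B) : Prop := {
  poisson_lie : lie_bracket (L := as_lmod B) br;
  poisson_leibniz : forall a b c, br a (b * c) = b * br a c + br a b * c
}.

Record complete_orthogonal_idempotents (A : assocAlgType K) (m : nat)
    (e : 'I_m -> A) : Prop := {
  coi_idem : forall v, e v * e v = e v;
  coi_orth : forall v w, v != w -> e v * e w = 0;
  coi_sum : \sum_(v < m) e v = 1
}.

End Notions.

Section CommutatorQuotient.
Variables (K : comPzRingType) (A : assocAlgType K).

Definition commutators : {pred A} :=
  fun x =>
    `[< span (V := as_lmod A) (fun c => exists a b : A, c = a * b - b * a) x >].

Lemma commutators_zmod_closed : zmod_closed commutators.
Proof.
split=> [|x y /asboolP hx /asboolP hy]; apply/asboolP; first exact: span0.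
by apply: (@spanD K (as_lmod A)) => //; rewrite -ascaleN1; apply: spanZ.
Qed.
HB.instance Definition _ :=
  GRing.isZmodClosed.Build A commutators commutators_zmod_closed.

Definition comm_quot := @Quotient.quot A commutators.
HB.instance Definition _ := GRing.Zmodule.on comm_quot.

Definition cq_pi (a : A) : comm_quot :=
  (\pi_(@Quotient.quot A commutators) a)%qT.

Lemma cq_piP (a b : A) : cq_pi a = cq_pi b <-> a - b \in commutators.
Proof.
rewrite Quotient.idealrBE; split; first by move=> h; apply/eqP; exact: h.
by move/eqP.
Qed.

Lemma cq_piD (a b : A) : cq_pi (a + b) = cq_pi a + cq_pi b.
Proof. exact: Quotient.pi_add. Qed.

Definition cq_repr (x : comm_quot) : A :=
  repr (x : @Quotient.quot A commutators).

Lemma cq_reprK x : cq_pi (cq_repr x) = x.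
Proof. exact: reprK. Qed.

Definition cq_scale (k : K) (x : comm_quot) : comm_quot :=
  cq_pi (ascale k (cq_repr x)).

Lemma cq_scale_pi k a : cq_scale k (cq_pi a) = cq_pi (ascale k a).
Proof.
apply/cq_piP; rewrite -(@scalerBr K (as_lmod A)); apply/asboolP/spanZ/asboolP.
by apply/cq_piP; rewrite cq_reprK.
Qed.

Lemma cq_scaleA k l x : cq_scale k (cq_scale l x) = cq_scale (k * l) x.
Proof. by rewrite -[x]cq_reprK !cq_scale_pi ascaleA. Qed.

Lemma cq_scale1 : left_id 1 cq_scale.
Proof. by move=> x; rewrite -[x]cq_reprK cq_scale_pi ascale1. Qed.

Lemma cq_scaleDr : right_distributive cq_scale +%R.
Proof.
move=> k x y; rewrite -[x]cq_reprK -[y]cq_reprK -cq_piD !cq_scale_pi.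
by rewrite ascaleDr cq_piD.
Qed.

Lemma cq_scaleDl x : {morph cq_scale^~ x : k l / k + l}.
Proof. by move=> k l; rewrite -[x]cq_reprK !cq_scale_pi ascaleDl cq_piD. Qed.

HB.instance Definition _ := GRing.Zmodule_isLmodule.Build K comm_quot
  cq_scaleA cq_scale1 cq_scaleDr cq_scaleDl.

Lemma cq_pi_linear : linear (cq_pi : as_lmod A -> comm_quot).
Proof. by move=> k a b; rewrite cq_piD -cq_scale_pi. Qed.

Record nc_poisson_structure
    (br : comm_quot -> comm_quot -> comm_quot) : Prop := {
  ncp_lie : lie_bracket br;
  ncp_derivation : forall a : A, exists2 d : A -> A,
    derivation d & forall b, br (cq_pi a) (cq_pi b) = cq_pi (d b)
}.

End CommutatorQuotient.

Section RepresentationScheme.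
Variables (K : comPzRingType) (A : assocAlgType K).
Variables (m : nat) (e : 'I_m -> A) (alpha : 'I_m -> nat).

Definition rep_dim : nat := (\sum_(v < m) alpha v)%N.

(* Indices are 0-based: block v consists of the i with                        *)
(* \sum_(w < v) alpha w <= i < \sum_(w <= v) alpha w.                         *)
Definition block_idem (v : 'I_m) (i j : 'I_rep_dim) : K :=
  ((i == j) &&
   (\sum_(w < m | w < v) alpha w <= i < \sum_(w < m | w <= v) alpha w)%N)%:R.

(* K[Rep(A, alpha)] is the quotient of the polynomial expressions in the      *)
(* symbols a_ij by the least congruence containing the axioms of commutative  *)
(* K-algebras and the three families of defining relations.                   *)
Inductive rep_expr : Type :=
| RGen (a : A) (i j : 'I_rep_dim)
| RConst (k : K)
| RAdd (s t : rep_expr)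
| RMul (s t : rep_expr).

Inductive rep_rel : rep_expr -> rep_expr -> Prop :=
| rr_refl t : rep_rel t t
| rr_sym s t : rep_rel s t -> rep_rel t s
| rr_trans s t u : rep_rel s t -> rep_rel t u -> rep_rel s u
| rr_add s s' t t' :
    rep_rel s s' -> rep_rel t t' -> rep_rel (RAdd s t) (RAdd s' t')
| rr_mul s s' t t' :
    rep_rel s s' -> rep_rel t t' -> rep_rel (RMul s t) (RMul s' t')
| rr_addA s t u : rep_rel (RAdd s (RAdd t u)) (RAdd (RAdd s t) u)
| rr_addC s t : rep_rel (RAdd s t) (RAdd t s)
| rr_add0 t : rep_rel (RAdd (RConst 0) t) t
| rr_mulA s t u : rep_rel (RMul s (RMul t u)) (RMul (RMul s t) u)
| rr_mulC s t : rep_rel (RMul s t) (RMul t s)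
| rr_mul1 t : rep_rel (RMul (RConst 1) t) t
| rr_mul0 t : rep_rel (RMul (RConst 0) t) (RConst 0)
| rr_mulD s t u : rep_rel (RMul (RAdd s t) u) (RAdd (RMul s u) (RMul t u))
| rr_constD k l : rep_rel (RConst (k + l)) (RAdd (RConst k) (RConst l))
| rr_constM k l : rep_rel (RConst (k * l)) (RMul (RConst k) (RConst l))
| rr_gen_mul (a b : A) i j :
    rep_rel (RGen (a * b) i j)
      (\big[RAdd/RConst 0]_(k < rep_dim) RMul (RGen a i k) (RGen b k j))
| rr_gen_lin (k l : K) (a b : A) i j :
    rep_rel (RGen (ascale k a + ascale l b) i j)
      (RAdd (RMul (RConst k) (RGen a i j)) (RMul (RConst l) (RGen b i j)))
| rr_gen_idem v i j : rep_rel (RGen (e v) i j) (RConst (block_idem v i j)).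

HB.instance Definition _ := gen_eqMixin rep_expr.
HB.instance Definition _ := gen_choiceMixin rep_expr.

Definition rep_relb : rel rep_expr := fun s t => `[< rep_rel s t >].

Lemma rep_relb_equiv : equiv_class_of rep_relb.
Proof.
split=> [t|s t|t s u].
- exact/asboolP/rr_refl.
- by apply/asboolP/asboolP => /rr_sym.
- by move=> /asboolP h /asboolP h'; apply/asboolP; apply: rr_trans h h'.
Qed.

Canonical rep_relb_equivRel := EquivRelPack rep_relb_equiv.
Canonical rep_relb_encModRel := defaultEncModRel rep_relb.

Definition rep_ring := {eq_quot rep_relb}%qT.
HB.instance Definition _ : EqQuotient _ rep_relb rep_ring :=
  EqQuotient.on rep_ring.
HB.instance Definition _ := Choice.on rep_ring.

Definition rep_pi (t : rep_expr) : rep_ring := (\pi_rep_ring t)%qT.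

Lemma rep_piP s t : rep_pi s = rep_pi t <-> rep_rel s t.
Proof.
split=> [/eqP|h]; last by apply/eqP; rewrite eqmodE; apply/asboolP.
by rewrite eqmodE => /asboolP.
Qed.

Lemma rep_ind (P : rep_ring -> Prop) :
  (forall t, P (rep_pi t)) -> forall x, P x.
Proof. by move=> h x; rewrite -[x]reprK. Qed.

Definition rep_add (x y : rep_ring) : rep_ring :=
  rep_pi (RAdd (repr x) (repr y)).
Definition rep_mul (x y : rep_ring) : rep_ring :=
  rep_pi (RMul (repr x) (repr y)).
Definition rep_const (k : K) : rep_ring := rep_pi (RConst k).
Definition rep_opp (x : rep_ring) : rep_ring := rep_mul (rep_const (-1)) x.
Definition rep_scale (k : K) (x : rep_ring) : rep_ring :=
  rep_mul (rep_const k) x.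

Lemma repr_rep_pi t : rep_rel (repr (rep_pi t)) t.
Proof. by apply/rep_piP; exact: reprK. Qed.

Lemma rep_add_pi s t : rep_add (rep_pi s) (rep_pi t) = rep_pi (RAdd s t).
Proof. by apply/rep_piP; apply: rr_add; exact: repr_rep_pi. Qed.

Lemma rep_mul_pi s t : rep_mul (rep_pi s) (rep_pi t) = rep_pi (RMul s t).
Proof. by apply/rep_piP; apply: rr_mul; exact: repr_rep_pi. Qed.

Lemma rep_constD k l : rep_const (k + l) = rep_add (rep_const k) (rep_const l).
Proof. by rewrite rep_add_pi; apply/rep_piP/rr_constD. Qed.

Lemma rep_constM k l : rep_const (k * l) = rep_mul (rep_const k) (rep_const l).
Proof. by rewrite rep_mul_pi; apply/rep_piP/rr_constM. Qed.

Lemma rep_addA : associative rep_add.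
Proof.
elim/rep_ind=> s; elim/rep_ind=> t; elim/rep_ind=> u.
by rewrite !rep_add_pi; apply/rep_piP/rr_addA.
Qed.

Lemma rep_addC : commutative rep_add.
Proof.
elim/rep_ind=> s; elim/rep_ind=> t.
by rewrite !rep_add_pi; apply/rep_piP/rr_addC.
Qed.

Lemma rep_add0 : left_id (rep_const 0) rep_add.
Proof. by elim/rep_ind=> t; rewrite rep_add_pi; apply/rep_piP/rr_add0. Qed.

Lemma rep_mulA : associative rep_mul.
Proof.
elim/rep_ind=> s; elim/rep_ind=> t; elim/rep_ind=> u.
by rewrite !rep_mul_pi; apply/rep_piP/rr_mulA.
Qed.

Lemma rep_mulC : commutative rep_mul.
Proof.
elim/rep_ind=> s; elim/rep_ind=> t.
by rewrite !rep_mul_pi; apply/rep_piP/rr_mulC.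
Qed.

Lemma rep_mul1 : left_id (rep_const 1) rep_mul.
Proof. by elim/rep_ind=> t; rewrite rep_mul_pi; apply/rep_piP/rr_mul1. Qed.

Lemma rep_mul0 : left_zero (rep_const 0) rep_mul.
Proof. by elim/rep_ind=> t; rewrite rep_mul_pi; apply/rep_piP/rr_mul0. Qed.

Lemma rep_mulDl : left_distributive rep_mul rep_add.
Proof.
elim/rep_ind=> s; elim/rep_ind=> t; elim/rep_ind=> u.
by rewrite !(rep_add_pi, rep_mul_pi); apply/rep_piP/rr_mulD.
Qed.

Lemma rep_addN : left_inverse (rep_const 0) rep_opp rep_add.
Proof.
move=> x; rewrite /rep_opp -[X in rep_add _ X]rep_mul1 -rep_mulDl -rep_constD.
by rewrite addNr rep_mul0.
Qed.

HB.instance Definition _ :=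
  GRing.isZmodule.Build rep_ring rep_addA rep_addC rep_add0 rep_addN.

Lemma rep_mulr1 : right_id (rep_const 1) rep_mul.
Proof. by move=> x; rewrite rep_mulC rep_mul1. Qed.

Lemma rep_mulDr : right_distributive rep_mul rep_add.
Proof. by move=> x y z; rewrite !(rep_mulC x) rep_mulDl. Qed.

HB.instance Definition _ := GRing.Zmodule_isPzRing.Build rep_ring
  rep_mulA rep_mul1 rep_mulr1 rep_mulDl rep_mulDr.
HB.instance Definition _ :=
  GRing.PzRing_hasCommutativeMul.Build rep_ring rep_mulC.

Lemma rep_scaleA k l x : rep_scale k (rep_scale l x) = rep_scale (k * l) x.
Proof. by rewrite /rep_scale rep_mulA rep_constM. Qed.

Lemma rep_scaleDr : right_distributive rep_scale +%R.
Proof. by move=> k x y; exact: rep_mulDr. Qed.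

Lemma rep_scaleDl x : {morph rep_scale^~ x : k l / k + l}.
Proof. by move=> k l; rewrite /rep_scale rep_constD rep_mulDl. Qed.

Lemma rep_scaleAr k x y : rep_scale k (x * y) = x * rep_scale k y.
Proof. by rewrite mulrC /rep_scale [LHS]rep_mulA mulrC. Qed.

HB.instance Definition _ := isAssocAlgebra.Build K rep_ring
  rep_scaleA rep_mul1 rep_scaleDr rep_scaleDl
  (fun k => rep_mulA (rep_const k)) rep_scaleAr.

Definition rep_gen (a : A) (i j : 'I_rep_dim) : rep_ring := rep_pi (RGen a i j).

Lemma rep_genM (a b : A) i j :
  rep_gen (a * b) i j = \sum_(k < rep_dim) rep_gen a i k * rep_gen b k j.
Proof.
rewrite /rep_gen; have /rep_piP -> := rr_gen_mul a b i j.
elim/big_rec2: _ => // k x y _ <-.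
by rewrite [X in X + _]rep_mul_pi [RHS]rep_add_pi.
Qed.

Lemma rep_gen_linear i j :
  linear ((fun a => rep_gen a i j) : as_lmod A -> as_lmod rep_ring).
Proof.
move=> k a b; rewrite -{1}[b](@ascale1 K) /rep_gen.
have /rep_piP -> := rr_gen_lin k 1 a b i j.
by rewrite -rep_add_pi -!rep_mul_pi -[in RHS](rep_mul1 (rep_pi (RGen b i j))).
Qed.

Lemma rep_gen_idem v i j : rep_gen (e v) i j = ascale (block_idem v i j) 1.
Proof.
have /rep_piP := rr_gen_idem v i j; rewrite -/(rep_gen _ _ _) => ->.
by rewrite [RHS]rep_mulr1.
Qed.

Definition rep_tr (a : A) : rep_ring := \sum_(i < rep_dim) rep_gen a i i.

Lemma rep_tr_linear : linear (rep_tr : as_lmod A -> as_lmod rep_ring).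
Proof.
move=> k a b; rewrite /rep_tr scaler_sumr -big_split /=.
by apply: eq_bigr => i _; exact: rep_gen_linear.
Qed.

Lemma rep_trC (a b : A) : rep_tr (a * b) = rep_tr (b * a).
Proof.
rewrite /rep_tr (eq_bigr _ (fun i _ => rep_genM a b i i)) exchange_big /=.
by apply: eq_bigr => i _; rewrite rep_genM; apply: eq_bigr => k _; exact: mulrC.
Qed.

Definition trace_subalg : {pred rep_ring} :=
  fun x => `[< subalg_gen (fun y => exists a, y = rep_tr a) x >].

Lemma trace_subring_closed : subring_closed trace_subalg.
Proof.
split=> [|x y /asboolP hx /asboolP hy|x y /asboolP hx /asboolP hy];
  apply/asboolP.
- exact: subalg_gen1.
- by apply: subalg_genD => //; rewrite -ascaleN1; apply: subalg_genZ.
- exact: subalg_genM.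
Qed.

HB.instance Definition _ :=
  GRing.isSubringClosed.Build rep_ring trace_subalg trace_subring_closed.

Record trace_alg := TraceAlg {
  trace_val :> rep_ring;
  trace_valP : trace_val \in trace_subalg
}.

HB.instance Definition _ := [isSub for trace_val].
HB.instance Definition _ := [Choice of trace_alg by <:].
HB.instance Definition _ := GRing.SubChoice_isSubComPzRing.Build
  rep_ring trace_subalg trace_alg trace_subring_closed.

Lemma trace_scale_subproof (k : K) (x : trace_alg) :
  ascale k (trace_val x) \in trace_subalg.
Proof. by apply/asboolP/subalg_genZ/asboolP; exact: trace_valP. Qed.

Definition trace_scale (k : K) (x : trace_alg) : trace_alg :=
  TraceAlg (trace_scale_subproof k x).

Lemma trace_scaleA k l x :
  trace_scale k (trace_scale l x) = trace_scale (k * l) x.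
Proof. by apply: val_inj; exact: ascaleA. Qed.

Lemma trace_scale1 : left_id 1 trace_scale.
Proof. by move=> x; apply: val_inj; exact: ascale1. Qed.

Lemma trace_scaleDr : right_distributive trace_scale +%R.
Proof. by move=> k x y; apply: val_inj; exact: ascaleDr. Qed.

Lemma trace_scaleDl x : {morph trace_scale^~ x : k l / k + l}.
Proof. by move=> k l; apply: val_inj; exact: ascaleDl. Qed.

Lemma trace_scaleAl k x y : trace_scale k (x * y) = trace_scale k x * y.
Proof. by apply: val_inj; exact: ascaleAl. Qed.

Lemma trace_scaleAr k x y : trace_scale k (x * y) = x * trace_scale k y.
Proof. by apply: val_inj; exact: ascaleAr. Qed.

HB.instance Definition _ := isAssocAlgebra.Build K trace_alg
  trace_scaleA trace_scale1 trace_scaleDr trace_scaleDl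
  trace_scaleAl trace_scaleAr.

Lemma rep_tr_in (a : A) : rep_tr a \in trace_subalg.
Proof. by apply/asboolP/subalg_gen_gen; exists a. Qed.

Definition tr (a : A) : trace_alg := TraceAlg (rep_tr_in a).

Definition tr_quot (x : comm_quot A) : trace_alg := tr (cq_repr x).

Lemma tr_quotE (a : A) : tr_quot (cq_pi a) = tr a.
Proof.
have tr0 : rep_tr 0 = 0.
  have := rep_tr_linear 1 0 0; rewrite !scale1r !addr0 => h.
  by apply: (addrI (rep_tr 0)); rewrite -h addr0.
have trZ (k : K) (b : A) : rep_tr (ascale k b) = ascale k (rep_tr b).
  by have := rep_tr_linear k b 0; rewrite !addr0 tr0 addr0.
have trD (b c : A) : rep_tr (b + c) = rep_tr b + rep_tr c.
  by have := rep_tr_linear 1 b c; rewrite !scale1r.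
have trB (b c : A) : rep_tr (b - c) = rep_tr b - rep_tr c.
  by rewrite -ascaleN1 trD trZ ascaleN1.
have key x : x \in @commutators K A -> rep_tr x = 0.
  move=> /asboolP; elim=> [c [b [c' ->]]||x1 x2 _ h1 _ h2|k x1 _ h1] //.
  - by rewrite trB rep_trC subrr.
  - by rewrite trD h1 h2 addr0.
  - by rewrite trZ h1; exact: (@scaler0 K (as_lmod rep_ring)).
apply: val_inj => /=; apply/eqP; rewrite -subr_eq0 -trB; apply/eqP/key.
by apply/cq_piP; rewrite cq_reprK.
Qed.

End RepresentationScheme.

Arguments tr {K A m} e alpha a.
Arguments tr_quot {K A m} e alpha x.

(* Main.v *)
Require Import Defs.
From HB Require Import structures.
From mathcomp Require Import all_boot all_algebra.
From mathcomp Require Import boolp ring.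

Set Implicit Arguments.
Unset Strict Implicit.
Unset Printing Implicit Defensive.

Import GRing.Theory.
Local Open Scope ring_scope.

(** A derivation of [A] may be corrected by an inner derivation, which induces
    zero on [A/[A,A]], so as to kill the idempotents [e_v]
    ([derivation_kill_idempotents]).  The corrected derivation [d] acts on
    [K[Rep(A, alpha)]] by [a_ij |-> (d a)_ij] ([rep_derivation]), because it
    respects the three families of defining relations.  Hence every element
    [x] of the Lie algebra [L = A/[A,A]] acts on the subalgebra generated by
    traces through a derivation [D_x] with [D_x (tr y) = tr <x, y>]
    ([trace_derivation]).

    What remains is a statement about a commutative algebra [B] generated by
    the image of an additive map [t : L -> B] from a Lie algebra, together
    with derivations [D_x] of [B] such that [D_x (t y) = t [x, y]]
    ([poisson_extension]).  Defining [{f, g}] by writing [f] as a polynomial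
    in the generators raises the question of whether the result depends on
    the polynomial.  It does not, since the derivation [X = {f, -}] satisfies
    [X (t y) = - D_y f], whose right-hand side involves only the element [f],
    and a derivation is determined by its values on generators.  So each [f]
    has exactly one Hamiltonian derivation; existence follows by induction on
    the way [f] is built from generators, the case of a generator being the
    antisymmetry [t [x, y] = - t [y, x]].  Every remaining identity for the
    bracket is checked on generators and propagated by the Leibniz rule, and
    uniqueness is another instance of that principle. *)

(** * Linear maps and derivations *)

Section LinearMaps.
Variables (K : comPzRingType) (A A' : assocAlgType K) (f : A -> A').
Hypothesis flin : linear (f : as_lmod A -> as_lmod A').

Lemma alg_linearD : {morph f : x y / x + y}.
Proof. by move=> x y; have := flin 1 x y; rewrite !scale1r. Qed.

Lemma alg_linear0 : f 0 = 0.
Proof. by apply: (addrI (f 0)); rewrite -alg_linearD !addr0. Qed.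

Lemma alg_linearZ k : {morph f : x / ascale k x}.
Proof. by move=> x; have := flin k x 0; rewrite !addr0 alg_linear0 addr0. Qed.

End LinearMaps.

Section Derivations.
Variables (K : comPzRingType) (A : assocAlgType K).
Implicit Types (d : A -> A) (x y : A) (k : K).

Lemma ascale_r0 k : ascale k (0 : A) = 0.
Proof. exact: (@scaler0 K (as_lmod A)). Qed.

Lemma ascale_rN k x : ascale k (- x) = - ascale k x.
Proof. exact: (@scalerN K (as_lmod A)). Qed.

Lemma derivation_intro d :
  {morph d : x y / x + y} -> (forall k, {morph d : x / ascale k x}) ->
  (forall x y, d (x * y) = d x * y + x * d y) -> derivation d.
Proof.
move=> dD dZ dM; split=> // k x y.
by rewrite [LHS]dD; congr (_ + _); exact: dZ.
Qed.

Lemma derivationD d : derivation d -> {morph d : x y / x + y}.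
Proof. by case=> dlin _; exact: alg_linearD. Qed.

Lemma derivation0 d : derivation d -> d 0 = 0.
Proof. by case=> dlin _; exact: (alg_linear0 dlin). Qed.

Lemma derivationZ d k : derivation d -> {morph d : x / ascale k x}.
Proof. by case=> dlin _; exact: alg_linearZ. Qed.

Lemma derivationN d : derivation d -> {morph d : x / - x}.
Proof. by move=> dd x; rewrite -!(@ascaleN1 K) (derivationZ _ dd). Qed.

Lemma derivation1 d : derivation d -> d 1 = 0.
Proof.
move=> dd; apply: (addrI (d 1)); rewrite addr0.
by have := derivationM dd 1 1; rewrite !mulr1 mul1r => <-.
Qed.

Lemma derivation_sum d n (F : 'I_n -> A) :
  derivation d -> d (\sum_(i < n) F i) = \sum_(i < n) d (F i).
Proof.
by move=> dd; apply: big_morph; [exact: derivationD|exact: derivation0].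
Qed.

Lemma derivation_add d1 d2 : derivation d1 -> derivation d2 ->
  derivation (fun x => d1 x + d2 x).
Proof.
move=> h1 h2; apply: derivation_intro => [x y|k x|x y].
- by rewrite (derivationD h1) (derivationD h2) addrACA.
- by rewrite (derivationZ _ h1) (derivationZ _ h2) ascaleDr.
- by rewrite (derivationM h1) (derivationM h2) mulrDl mulrDr addrACA.
Qed.

Lemma derivation_opp d : derivation d -> derivation (fun x => - d x).
Proof.
move=> dd; apply: derivation_intro => [x y|k x|x y].
- by rewrite (derivationD dd) opprD.
- by rewrite (derivationZ _ dd) ascale_rN.
- by rewrite (derivationM dd) opprD mulNr mulrN.
Qed.

Lemma derivation_zero : derivation (fun=> 0 : A).
Proof.
apply: derivation_intro => [x y|k x|x y]; first by rewrite addr0.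
- by rewrite ascale_r0.
- by rewrite mul0r mulr0 addr0.
Qed.

Lemma derivation_inner c : derivation (fun x => c * x - x * c : A).
Proof.
apply: derivation_intro => [x y|k x|x y].
- by rewrite mulrDr mulrDl opprD addrACA.
- by rewrite -ascaleAr -ascaleAl ascaleDr ascale_rN.
- by rewrite mulrBl mulrBr !mulrA addrA subrK.
Qed.

Lemma eq_derivation (S : A -> Prop) d1 d2 :
  derivation d1 -> derivation d2 -> (forall x, S x -> d1 x = d2 x) ->
  forall x, subalg_gen S x -> d1 x = d2 x.
Proof.
move=> h1 h2 eqS x.
elim=> {x} [x /eqS //||x y _ ex _ ey|x y _ ex _ ey|k x _ ex].
- by rewrite !derivation1.
- by rewrite (derivationD h1) (derivationD h2) ex ey.
- by rewrite (derivationM h1) (derivationM h2) ex ey.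
- by rewrite (derivationZ _ h1) (derivationZ _ h2) ex.
Qed.

(** With [c = \sum_v d(e_v) e_v], expanding [d (e_w e_v)] by the Leibniz rule
    gives [[c, e_w] = d e_w], so [d - [c, -]] kills every [e_w]. *)
Lemma derivation_kill_idempotents m (e : 'I_m -> A) d :
  complete_orthogonal_idempotents e -> derivation d ->
  exists d', [/\ derivation d', forall v, d' (e v) = 0 &
                 forall x, cq_pi (d' x) = cq_pi (d x)].
Proof.
move=> [eid eorth esum] dd; pose c := \sum_(v < m) d (e v) * e v.
have sum_ew w (F : 'I_m -> A) : \sum_(v < m) F v * (e v * e w) = F w * e w.
  rewrite (bigD1 w) //= eid big1 ?addr0 // => v vw.
  by rewrite eorth // mulr0.
have cw w : c * e w = d (e w) * e w.
  rewrite mulr_suml -(sum_ew w (d \o e)).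
  by apply: eq_bigr => v _; rewrite mulrA.
have wc w : e w * c = d (e w) * e w - d (e w).
  rewrite mulr_sumr -[X in _ - X]mulr1 -esum mulr_sumr.
  transitivity (\sum_(v < m) (d (e w * e v) * e v - d (e w) * e v)).
    apply: eq_bigr => v _; apply/eqP.
    rewrite eq_sym subr_eq eq_sym (derivationM dd) mulrDl -!mulrA eid.
    by rewrite addrC.
  rewrite sumrB; congr (_ - _); rewrite (bigD1 w) //= eid big1 ?addr0 //.
  by move=> v vw; rewrite eorth 1?eq_sym // (derivation0 dd) mul0r.
exists (fun x => d x + - (c * x - x * c)); split.
- exact/derivation_add/derivation_opp/derivation_inner.
- by move=> w; rewrite cw wc opprB addrAC subrr add0r subrr.
- move=> x; apply/cq_piP; rewrite addrC addKr opprB.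
  by apply/asboolP/span_gen; exists x, c.
Qed.

End Derivations.

Section CommutativeDerivations.
Variables (K : comPzRingType) (B : comAssocAlgType K).
Implicit Types (d : B -> B).

Lemma derivation_lmul (c : B) d :
  derivation d -> derivation (fun x => c * d x).
Proof.
move=> dd; apply: derivation_intro => [x y|k x|x y].
- by rewrite (derivationD dd) mulrDr.
- by rewrite (derivationZ _ dd) ascaleAr.
- by rewrite (derivationM dd); ring.
Qed.

Lemma derivation_commutator d1 d2 : derivation d1 -> derivation d2 ->
  derivation (fun x => d1 (d2 x) - d2 (d1 x)).
Proof.
move=> h1 h2; apply: derivation_intro => [x y|k x|x y].
- rewrite (derivationD h2) !(derivationD h1) (derivationD h2).
  by rewrite opprD addrACA.
- rewrite (derivationZ _ h2) !(derivationZ _ h1) (derivationZ _ h2).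
  by rewrite ascaleDr ascale_rN.
- rewrite (derivationM h2) (derivationM h1) (derivationD h1) (derivationD h2).
  by rewrite !(derivationM h1) !(derivationM h2); ring.
Qed.

Lemma poisson_derivation (pb : B -> B -> B) f :
  poisson_bracket pb -> derivation (pb f).
Proof.
move=> [lie leib]; split; first exact: (lie_linearr lie).
by move=> x y; rewrite leib addrC.
Qed.

End CommutativeDerivations.

Lemma lie_bracketN (K : comPzRingType) (L : lmodType K) (br : L -> L -> L) :
  lie_bracket br -> forall x y, br x y = - br y x.
Proof.
move=> [linl linr alt _] x y.
have addl u v w : br (u + v) w = br u w + br v w.
  by have := linl w 1 u v; rewrite /= !scale1r.
have addr u v w : br w (u + v) = br w u + br w v.
  by have := linr w 1 u v; rewrite !scale1r.
have := alt (x + y); rewrite addl !addr !alt add0r addr0 => /eqP.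
by rewrite addr_eq0 => /eqP.
Qed.

(** * Extending a Lie algebra action to a Poisson bracket *)

Section PoissonExtension.
Variables (K : comPzRingType) (B : comAssocAlgType K).
Variables (L : lmodType K) (br : L -> L -> L) (t : L -> B) (D : L -> B -> B).
Hypothesis lieL : lie_bracket br.
Hypothesis tD : {morph t : x y / x + y}.
Let generator (f : B) := exists x, f = t x.
Hypothesis gen_t : forall f, subalg_gen generator f.
Hypothesis derD : forall x, derivation (D x).
Hypothesis Dt : forall x y, D x (t y) = t (br x y).

Lemma eq_derivation_gen d1 d2 :
  derivation d1 -> derivation d2 -> (forall x, d1 (t x) = d2 (t x)) ->
  d1 =1 d2.
Proof.
move=> h1 h2 h f; apply: (eq_derivation h1 h2) (gen_t f).
by move=> _ [x ->].
Qed.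

Lemma t0 : t 0 = 0.
Proof. by apply: (addrI (t 0)); rewrite -tD !addr0. Qed.

Lemma t_brN x y : t (br x y) = - t (br y x).
Proof.
by rewrite (lie_bracketN lieL); apply/eqP; rewrite -addr_eq0 -tD addNr t0.
Qed.

(** These are the derivations [X = {f, -}], where [{f, t x} = - {t x, f}] has
    been replaced by [- D_x f].  The condition on [X] mentions [f] only as an
    element of [B], so the bracket cannot depend on a presentation of [f]. *)
Definition hamiltonian (f : B) (X : B -> B) :=
  derivation X /\ forall x, X (t x) = - D x f.

Lemma hamiltonian_unique f X Y : hamiltonian f X -> hamiltonian f Y -> X =1 Y.
Proof.
by move=> [dX hX] [dY hY]; apply: eq_derivation_gen => // x; rewrite hX hY.
Qed.

Lemma hamiltonian_generator x : hamiltonian (t x) (D x).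
Proof. by split=> // y; rewrite !Dt t_brN. Qed.

Lemma hamiltonianD f g X Y : hamiltonian f X -> hamiltonian g Y ->
  hamiltonian (f + g) (fun h => X h + Y h).
Proof.
move=> [dX hX] [dY hY]; split; first exact: derivation_add.
by move=> x; rewrite hX hY (derivationD (derD x)) opprD.
Qed.

Lemma hamiltonianM f g X Y : hamiltonian f X -> hamiltonian g Y ->
  hamiltonian (f * g) (fun h => f * Y h + g * X h).
Proof.
move=> [dX hX] [dY hY].
split; first by apply: derivation_add; exact: derivation_lmul.
by move=> x; rewrite hX hY (derivationM (derD x)); ring.
Qed.

Lemma hamiltonianZ k f X : hamiltonian f X ->
  hamiltonian (ascale k f) (fun h => ascale k (X h)).
Proof.
move=> [dX hX]; split; last first.
  by move=> x; rewrite hX (derivationZ _ (derD x)) ascale_rN.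
apply: derivation_intro => [x y|l x|x y].
- by rewrite (derivationD dX) ascaleDr.
- by rewrite (derivationZ _ dX) !ascaleA mulrC.
- by rewrite (derivationM dX) ascaleDr ascaleAl ascaleAr.
Qed.

Lemma hamiltonian_exists f : exists X, hamiltonian f X.
Proof.
elim: (gen_t f) => [_ [x ->]||g h _ [X hX] _ [Y hY]|g h _ [X hX] _ [Y hY]|].
- by exists (D x); exact: hamiltonian_generator.
- exists (fun=> 0); split; first exact: derivation_zero.
  by move=> x; rewrite (derivation1 (derD x)) oppr0.
- by exists (fun u => X u + Y u); exact: hamiltonianD.
- by exists (fun u => g * Y u + h * X u); exact: hamiltonianM.
- by move=> k g _ [X hX]; exists (fun u => ascale k (X u)); exact: hamiltonianZ.
Qed.

Section Bracket.
Variable pb : B -> B -> B.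
Hypothesis ham : forall f, hamiltonian f (pb f).

Lemma bracket_derr f : derivation (pb f).
Proof. by case: (ham f). Qed.

Lemma bracket_generatorl x : pb (t x) =1 D x.
Proof.
by apply: hamiltonian_unique; [exact: ham|exact: hamiltonian_generator].
Qed.

Lemma bracket_derl h : derivation (pb ^~ h).
Proof.
apply: derivation_intro => [f g|k f|f g] /=.
- exact: hamiltonian_unique (ham _) (hamiltonianD (ham _) (ham _)) h.
- exact: hamiltonian_unique (ham _) (hamiltonianZ k (ham _)) h.
- rewrite (hamiltonian_unique (ham _) (hamiltonianM (ham f) (ham g)) h).
  by rewrite addrC [g * _]mulrC.
Qed.

Lemma bracketN f g : pb f g = - pb g f.
Proof.
apply: (eq_derivation_gen (bracket_derr f) (derivation_opp (bracket_derl f))).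
by move=> x; rewrite bracket_generatorl (ham f).2.
Qed.

(** Antisymmetry does not suffice, as [2] may be a zero divisor in [K]: the
    diagonal needs an induction of its own. *)
Lemma bracket_alternating f : pb f f = 0.
Proof.
elim: (gen_t f) => [_ [x ->]||g h _ eg _ eh|g h _ eg _ eh|k g _ eg].
- by rewrite bracket_generatorl Dt (lie_alternating lieL) t0.
- exact: derivation1 (bracket_derr 1).
- rewrite (derivationD (bracket_derr _)) !(derivationD (bracket_derl _)).
  by rewrite eg eh (bracketN h g); ring.
- rewrite (derivationM (bracket_derr _)) !(derivationM (bracket_derl _)).
  by rewrite eg eh (bracketN h g); ring.
- rewrite (derivationZ _ (bracket_derr _)) (derivationZ _ (bracket_derl _)) eg.
  by rewrite !ascale_r0.
Qed.

Let jac f g h := pb f (pb g h) + pb g (pb h f) + pb h (pb f g).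

Let jacC f g h : jac f g h = jac g h f.
Proof. by rewrite /jac -addrA addrC. Qed.

(** By antisymmetry the Jacobi identity says that [[pb f, pb g]] and
    [pb (pb f g)] agree; both are derivations, hence it is enough to evaluate
    them at generators. *)
Let jac_generator f g :
  (forall x, jac f g (t x) = 0) -> forall h, jac f g h = 0.
Proof.
have jacE h : jac f g h = pb f (pb g h) - pb g (pb f h) - pb (pb f g) h.
  rewrite /jac (bracketN h f) (bracketN h (pb f g)).
  by rewrite (derivationN (bracket_derr g)).
move=> h0 h; rewrite jacE; apply/eqP; rewrite subr_eq0; apply/eqP.
have dc := derivation_commutator (bracket_derr f) (bracket_derr g).
apply: (eq_derivation_gen dc (bracket_derr (pb f g))).
by move=> x; apply/eqP; rewrite -subr_eq0 -jacE h0.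
Qed.

Lemma bracket_jacobi f g h : jac f g h = 0.
Proof.
(* One argument at a time is freed, then the arguments are rotated. *)
apply: jac_generator => z; rewrite -jacC.
apply: jac_generator => y; rewrite -jacC.
apply: jac_generator => x; rewrite /jac !bracket_generatorl !Dt -!tD.
by rewrite (lie_jacobi lieL) t0.
Qed.

Lemma bracket_poisson : poisson_bracket pb.
Proof.
split; last by move=> a b c; rewrite (derivationM (bracket_derr a)) addrC.
split.
- by move=> f; exact: (derivation_linear (bracket_derl f)).
- by move=> f; exact: (derivation_linear (bracket_derr f)).
- exact: bracket_alternating.
- exact: bracket_jacobi.
Qed.

End Bracket.

(** The generators [t x] may satisfy relations, so the bracket is selected
    through Hamiltonian derivations and not defined by a formula in [t x]. *)
Lemma poisson_extension :
  exists! pb : B -> B -> B,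
    poisson_bracket pb /\ forall x y, pb (t x) (t y) = t (br x y).
Proof.
have [pb ham] := choice hamiltonian_exists.
exists pb; split.
  split; first exact: bracket_poisson.
  by move=> x y; rewrite bracket_generatorl // Dt.
move=> pb' [hpb' pb't]; apply: funext => f; apply: funext => g.
apply: hamiltonian_unique (ham f) _ g.
split; first exact: poisson_derivation.
move=> x; rewrite (lie_bracketN (poisson_lie hpb')); congr (- _).
apply: (eq_derivation_gen (poisson_derivation _ hpb') (derD x)).
by move=> y; rewrite pb't Dt.
Qed.

End PoissonExtension.

(** * Derivations of the representation scheme *)

Section RepDerivation.
Variables (K : comPzRingType) (A : assocAlgType K).
Variables (m : nat) (e : 'I_m -> A) (alpha : 'I_m -> nat).
Variable d : A -> A.
Hypothesis dd : derivation d.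
Hypothesis de0 : forall v, d (e v) = 0.

Local Notation R := (rep_ring e alpha).
Local Notation T := (trace_alg e alpha).

Lemma rep_piD (s u : rep_expr A alpha) :
  rep_pi e (RAdd s u) = rep_pi e s + rep_pi e u :> R.
Proof. by rewrite -rep_add_pi. Qed.

Lemma rep_piM (s u : rep_expr A alpha) :
  rep_pi e (RMul s u) = rep_pi e s * rep_pi e u :> R.
Proof. by rewrite -rep_mul_pi. Qed.

Lemma rep_pi_const k : rep_pi e (RConst A alpha k) = ascale k 1 :> R.
Proof. by rewrite [RHS]rep_mulr1. Qed.

(** The values are taken in the quotient ring and not in the expressions, so
    that compatibility with the congruence becomes a ring identity. *)
Fixpoint der_expr (s : rep_expr A alpha) : R :=
  match s with
  | RGen a i j => rep_gen e (d a) i j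
  | RConst _ => 0
  | RAdd s u => der_expr s + der_expr u
  | RMul s u => der_expr s * rep_pi e u + rep_pi e s * der_expr u
  end.

(** The matrix product relations are preserved because [d] is a derivation,
    the linear ones because it is linear, and the relations on the
    idempotents because [d] kills them while their right-hand sides are
    constants. *)
Lemma der_expr_rel s u : rep_rel e s u -> der_expr s = der_expr u.
Proof.
have gen_lin i j := rep_gen_linear e (alpha := alpha) i j.
have genD i j a b := alg_linearD (gen_lin i j) a b.
have genZ i j k a := alg_linearZ (gen_lin i j) k a.
have gen0 i j := alg_linear0 (gen_lin i j).
elim=> {s u} //=.
- by move=> s u v _ -> _ ->.
- by move=> s s' u u' _ -> _ ->.
- move=> s s' u u' /rep_piP ess' -> /rep_piP euu' ->.
  by rewrite ess' euu'.
- by move=> s u v; rewrite addrA.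
- by move=> s u; rewrite addrC.
- by move=> s; rewrite add0r.
- by move=> s u v; rewrite !rep_piM; ring.
- by move=> s u; ring.
- move=> s; rewrite rep_pi_const ascale1; ring.
- move=> s; rewrite [rep_pi e (RConst _ _ _)](_ : _ = 0 :> R) //; ring.
- by move=> s u v; rewrite !rep_piD; ring.
- by move=> k l; rewrite addr0.
- by move=> k l; rewrite mul0r mulr0 addr0.
- move=> a b i j.
  have der0 : der_expr (RConst A alpha 0) = 0 by [].
  rewrite (big_morph der_expr (fun _ _ => erefl) der0).
  by rewrite (derivationM dd) genD !rep_genM -big_split.
- move=> k l a b i j; rewrite (derivationD dd) !(derivationZ _ dd) genD !genZ.
  by rewrite !rep_pi_const !mul0r !add0r -!ascaleAl !mul1r.
- by move=> v i j; rewrite de0 gen0.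
Qed.

Definition rep_derivation (x : R) : R := der_expr (repr x).

Lemma rep_derivation_pi s : rep_derivation (rep_pi e s) = der_expr s.
Proof. exact/der_expr_rel/repr_rep_pi. Qed.

Lemma rep_derivationP : derivation rep_derivation.
Proof.
apply: derivation_intro => [|k|].
- elim/rep_ind=> s; elim/rep_ind=> u.
  by rewrite -rep_piD !rep_derivation_pi.
- elim/rep_ind=> s.
  rewrite -[rep_pi e s]mul1r !ascaleAl -rep_pi_const -rep_piM.
  by rewrite mul1r !rep_derivation_pi /= mul0r add0r.
- elim/rep_ind=> s; elim/rep_ind=> u.
  by rewrite -rep_piM !rep_derivation_pi.
Qed.

Lemma rep_derivation_tr a :
  rep_derivation (rep_tr e alpha a) = rep_tr e alpha (d a).
Proof.
rewrite derivation_sum; last exact: rep_derivationP.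
by apply: eq_bigr => i _; rewrite rep_derivation_pi.
Qed.

Lemma rep_derivation_trace_subalg (x : R) :
  x \in @trace_subalg K A m e alpha ->
  rep_derivation x \in @trace_subalg K A m e alpha.
Proof.
have dR := rep_derivationP.
move=> /asboolP hx; apply/asboolP.
elim: hx => {x} [_ [a ->]||x y _ hx _ hy|x y gx hx gy hy|k x _ hx].
- by rewrite rep_derivation_tr; apply: subalg_gen_gen; exists (d a).
- rewrite (derivation1 dR) -(subrr (1 : R)) -(@ascaleN1 K).
  by apply: subalg_genD; [|apply: subalg_genZ]; exact: subalg_gen1.
- by rewrite (derivationD dR); exact: subalg_genD.
- by rewrite (derivationM dR); apply: subalg_genD; exact: subalg_genM.
- by rewrite (derivationZ _ dR); exact: subalg_genZ.
Qed.

Lemma trace_derivation :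
  exists D : T -> T, derivation D /\
    forall a, D (tr e alpha a) = tr e alpha (d a).
Proof.
exists (fun x => TraceAlg (rep_derivation_trace_subalg (trace_valP x))).
have dR := rep_derivationP.
split; last by move=> a; apply: val_inj; exact: rep_derivation_tr.
apply: derivation_intro => [x y|k x|x y]; apply: val_inj => /=.
- exact: (derivationD dR).
- exact: (derivationZ k dR).
- exact: (derivationM dR).
Qed.

End RepDerivation.

(** * Traces *)

Section Traces.
Variables (K : comPzRingType) (A : assocAlgType K).
Variables (m : nat) (e : 'I_m -> A) (alpha : 'I_m -> nat).

Lemma tr_quotD : {morph tr_quot e alpha : x y / x + y}.
Proof.
move=> x y; rewrite -[x]cq_reprK -[y]cq_reprK -cq_piD !tr_quotE.
by apply: val_inj; exact: (alg_linearD (@rep_tr_linear K A m e alpha)).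
Qed.

(** Generation holds inside the algebra of traces itself, since each partial
    expression of an element in terms of traces lies in it too. *)
Lemma trace_alg_gen (f : trace_alg e alpha) :
  subalg_gen (fun g => exists x, g = tr_quot e alpha x) f.
Proof.
case: f => f fT; have /asboolP := fT => gf.
elim: gf fT => {f} [_ [a ->]||f g gf hf gg hg|f g gf hf gg hg|k f gf hf] fT.
- apply: subalg_gen_gen; exists (cq_pi a); rewrite tr_quotE.
  exact: val_inj.
- by rewrite (_ : TraceAlg fT = 1); [exact: subalg_gen1|exact: val_inj].
- have [/asboolP Tf /asboolP Tg] := conj gf gg.
  rewrite (_ : TraceAlg fT = TraceAlg Tf + TraceAlg Tg); last exact: val_inj.
  exact: subalg_genD.
- have [/asboolP Tf /asboolP Tg] := conj gf gg.
  rewrite (_ : TraceAlg fT = TraceAlg Tf * TraceAlg Tg); last exact: val_inj.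
  exact: subalg_genM.
- have /asboolP Tf := gf.
  rewrite (_ : TraceAlg fT = ascale k (TraceAlg Tf)); last exact: val_inj.
  exact: subalg_genZ.
Qed.

End Traces.

Theorem theorem2p5 (K : comPzRingType) (A : assocAlgType K)
    (m : nat) (e : 'I_m -> A) (he : complete_orthogonal_idempotents e)
    (br : comm_quot A -> comm_quot A -> comm_quot A)
    (hbr : nc_poisson_structure br) (alpha : 'I_m -> nat) :
  exists! pb : trace_alg e alpha -> trace_alg e alpha -> trace_alg e alpha,
    poisson_bracket pb /\
    forall a b : A,
      pb (tr e alpha a) (tr e alpha b)
      = tr_quot e alpha (br (cq_pi a) (cq_pi b)).
Proof.
have action x : exists D : trace_alg e alpha -> trace_alg e alpha,
    derivation D /\
    forall y, D (tr_quot e alpha y) = tr_quot e alpha (br x y).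
  rewrite -[x]cq_reprK; have [d dd brd] := ncp_derivation hbr (cq_repr x).
  have [d' [dd' d'e0 d'd]] := derivation_kill_idempotents he dd.
  have [D [dD Dtr]] := trace_derivation alpha dd' d'e0.
  exists D; split=> // y; rewrite -[y]cq_reprK brd -d'd !tr_quotE.
  exact: Dtr.
have [D DP] := choice action.
have [pb [[hpb pbt] pb_uniq]] := poisson_extension (ncp_lie hbr)
  (@tr_quotD K A m e alpha) (@trace_alg_gen K A m e alpha)
  (fun x => (DP x).1) (fun x => (DP x).2).
exists pb; split; first by split=> // a b; rewrite -pbt !tr_quotE.
move=> pb' [hpb' pb't]; apply: pb_uniq; split=> // x y.
by rewrite -{1}[x]cq_reprK -{1}[y]cq_reprK !tr_quotE pb't !cq_reprK.
Qed.
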